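(* (Bowen pressure formula) Let $(X,d)$ be a compact metric space, $f:X\to X$ a continuous map, $u:X\to\mathbb{R}$ a positive continuous function, and $Z\subset X$. Then the equation $P_{Z,p}(-\alpha u)=0$ in the unknown $\alpha$ has a unique root $\alpha$, and $\dim_{\rm BSP}Z=\alpha$. Here $P_{Z,p}$ is the packing topological pressure and $\dim_{\rm BSP}$ is the BS-packing dimension (with respect to $u$).
   Context: Bowen balls: for $n\in\mathbb{N}=\{1,2,\dots\}$, $d_n(x,y)=\max\{d(f^kx,f^ky):0\le k\le n-1\}$ and $\overline B_n(x,\varepsilon)=\{y\in X: d_n(x,y)\le\varepsilon\}$. A ball $B=\overline B_n(x,\varepsilon)$ is regarded as carrying its length $n(B)=n$ and its center $x_B=x$. Put $u(B)=\sup_{y\in B}\sum_{i=0}^{n(B)-1}u(f^iy)$. BS-packing dimension: for $Z\subset X$, $\alpha>0$, $N\in\mathbb{N}$, $\varepsilon>0$ let $P(Z,\alpha,\varepsilon,N)=\sup_{\mathcal G}\sum_{B\in\mathcal G}\exp(-\alpha u(B))$, the supremum over all finite or countable pairwise disjoint families $\mathcal G=\{\overline B_{n_i}(x_i,\varepsilon)\}$ with $x_i\in Z$, $n_i\ge N$ for all $i$. Let $P^*(Z,\alpha,\varepsilon)=\lim_{N\to\infty}P(Z,\alpha,\varepsilon,N)$ and $P(Z,\alpha,\varepsilon)=\inf\{\sum_{i=1}^\infty P^*(Z_i,\alpha,\varepsilon):\bigcup_{i=1}^\infty Z_i\supseteq Z\}$. Let $\dim_{\rm BSP}(Z,\varepsilon)=\inf\{\alpha:P(Z,\alpha,\varepsilon)=0\}=\sup\{\alpha:P(Z,\alpha,\varepsilon)=\infty\}$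 and $\dim_{\rm BSP}Z=\lim_{\varepsilon\to0}\dim_{\rm BSP}(Z,\varepsilon)$. Packing topological pressure: for continuous $g:X\to\mathbb{R}$, $\beta\in\mathbb{R}$, $N\in\mathbb{N}$, $\varepsilon>0$, let $$P_p(g,Z,\beta,\varepsilon,N)=\sup_{\mathcal G}\sum_{B\in\mathcal G}\exp\Big(-\beta n(B)+\sup_{x\in B}\sum_{i=0}^{n(B)-1}g(f^ix)\Big),$$ the supremum over all finite or countable pairwise disjoint families $\mathcal G=\{\overline B_{n_i}(x_i,\varepsilon)\}$ with $x_i\in Z$, $n_i\ge N$ for all $i$. Let $P_p^*(g,Z,\beta,\varepsilon)=\lim_{N\to\infty}P_p(g,Z,\beta,\varepsilon,N)$ and $P_p(g,Z,\beta,\varepsilon)=\inf\{\sum_{i=1}^\infty P_p^*(g,Z_i,\beta,\varepsilon):\bigcup_{i=1}^\infty Z_i\supset Z\}$. Let $P_{Z,p}(g,\varepsilon)$ be the critical value of $\beta$ at which $P_p(g,Z,\beta,\varepsilon)$ jumps from $\infty$ to $0$ (it is $0$ for $\beta>P_{Z,p}(g,\varepsilon)$ and $\infty$ for $\beta<P_{Z,p}(g,\varepsilon)$), and $P_{Z,p}(g)=\lim_{\varepsilon\to0}P_{Z,p}(g,\varepsilon)$.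
   Formalization: Z is assumed nonempty, and the unique real root is claimed when P_{Z,p}(0) is finite; if P_{Z,p}(0)=+∞ (e.g. the full shift on [0,1]^ℤ, u=1) no real root exists, and it is shown instead that P_{Z,p}(-αu)=+∞ for all real α and dim_BSP Z=+∞. *)

(* Defs.v *)
From HB Require Import structures.
From mathcomp Require Import all_boot all_order all_algebra.
From mathcomp Require Import all_classical all_reals all_analysis.
Import Order.TTheory GRing.Theory Num.Theory.
Import numFieldTopology.Exports.

Set Implicit Arguments.
Unset Strict Implicit.
Unset Printing Implicit Defensive.

Local Open Scope classical_set_scope.
Local Open Scope ring_scope.
Local Open Scope ereal_scope.

Section bowen_packing.
Context {R : realType} {X : metricType R}.
Variable f : X -> X.
Implicit Types (g u : X -> R) (Z : set X) (eps : R) (w : nat -> X -> R).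

Definition bowen_dist (n : nat) (x y : X) : R :=
  (\big[Num.max/0%R]_(k < n) mdist (iter k f x) (iter k f y))%R.

Definition bowen_ball (n : nat) (x : X) eps : set X :=
  [set y | (bowen_dist n x y <= eps)%R].

Definition birkhoff_sum g (n : nat) (x : X) : R :=
  (\sum_(i < n) g (iter i f x))%R.

Definition sup_birkhoff g (n : nat) (x : X) eps : R :=
  sup [set birkhoff_sum g n y | y in bowen_ball n x eps].

(* A ball carries its length and its center, so a family of balls is a set of
   pairs (length, center). Distinct pairs must have disjoint balls, hence a
   given ball is never listed twice. *)
Definition packing_family Z eps (N : nat) : set (set (nat * X)) :=
  [set G | [/\ countable G,
    trivIset G (fun p => bowen_ball p.1 p.2 eps) &
    forall p, G p -> [/\ Z p.2, (0 < p.1)%N & (N <= p.1)%N]]].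

(* The three steps common to the packing dimension and the packing pressure,
   where [w n x] is the weight of the ball of length [n] and center [x]. *)
Definition packing_sup w Z eps (N : nat) : \bar R :=
  ereal_sup [set \esum_(p in G) (w p.1 p.2)%:E | G in packing_family Z eps N].

Definition packing_lim w Z eps : \bar R :=
  lim (packing_sup w Z eps N @[N --> \oo]).

Definition packing_outer w Z eps : \bar R :=
  ereal_inf [set \sum_(0 <= i <oo) packing_lim w (Zs i) eps
            | Zs in [set Zs : nat -> set X | Z `<=` \bigcup_i Zs i]].

Definition bsp_weight u (alpha eps : R) (n : nat) (x : X) : R :=
  expR (- alpha * sup_birkhoff u n x eps).

Definition bsp_dim_eps u Z eps : \bar R :=
  ereal_inf [set alpha%:E | alpha in
    [set alpha : R | (0 < alpha)%R /\
      packing_outer (bsp_weight u alpha eps) Z eps = 0]].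

Definition bsp_dim u Z : \bar R := lim (bsp_dim_eps u Z eps @[eps --> 0^'+]).

Definition pressure_weight g (beta eps : R) (n : nat) (x : X) : R :=
  expR (- beta * n%:R + sup_birkhoff g n x eps).

(* The jump from +oo to 0 at this value is [packing_pressure_eps_jump]. *)
Definition packing_pressure_eps g Z eps : \bar R :=
  ereal_inf [set beta%:E | beta in
    [set beta : R | packing_outer (pressure_weight g beta eps) Z eps = 0]].

Definition packing_pressure g Z : \bar R :=
  lim (packing_pressure_eps g Z eps @[eps --> 0^'+]).

Lemma packing_sup_ge0 w Z eps N : (forall n x, 0 <= w n x)%R ->
  0 <= packing_sup w Z eps N.
Proof.
move=> w0; apply: ereal_sup_ubound; exists set0; last by rewrite esum_set0.
by split => //; exact: trivIset_set0.
Qed.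

Lemma packing_sup_nonincreasing w Z eps :
  nonincreasing_seq (packing_sup w Z eps).
Proof.
move=> m n mn; apply: ereal_sup_le => _ [G [cG tG GP] <-]; exists G => //.
by split => // p /GP[Zp p0 np]; split => //; exact: leq_trans np.
Qed.

Lemma packing_limE w Z eps :
  packing_lim w Z eps = ereal_inf (range (packing_sup w Z eps)).
Proof.
apply/cvg_lim => //; apply: ereal_nonincreasing_cvgn.
exact: packing_sup_nonincreasing.
Qed.

Lemma packing_lim_ge0 w Z eps : (forall n x, 0 <= w n x)%R ->
  0 <= packing_lim w Z eps.
Proof.
move=> w0; rewrite packing_limE; apply: le_ereal_inf_tmp => _ [N _ <-].
exact: packing_sup_ge0.
Qed.

Lemma packing_outer_ge0 w Z eps : (forall n x, 0 <= w n x)%R ->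
  0 <= packing_outer w Z eps.
Proof.
move=> w0; apply: le_ereal_inf_tmp => _ [Zs _ <-].
by apply: nneseries_ge0 => i _ _; exact: packing_lim_ge0.
Qed.

Section jump.
Variables (w w' : nat -> X -> R) (r : R).
Hypotheses (w0 : forall n x, (0 <= w n x)%R) (w'0 : forall n x, (0 <= w' n x)%R).
Hypotheses (r0 : (0 <= r)%R) (r1 : (r < 1)%R).
Hypothesis ww' : forall n x, (w' n x <= r ^+ n * w n x)%R.

Let packing_sup_jump Z eps N :
  packing_sup w' Z eps N <= (r ^+ N)%:E * packing_sup w Z eps N.
Proof.
apply: ge_ereal_sup => _ [G [cG tG GP] <-].
apply: (@le_trans _ _ (\esum_(p in G) ((r ^+ N)%:E * (w p.1 p.2)%:E))).
  apply: le_esum => p /GP[_ _ Np]; rewrite -EFinM lee_fin.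
  apply: (le_trans (ww' _ _)); apply: ler_wpM2r => //.
  by rewrite ler_wiXn2l// ltW.
apply: (@le_trans _ _ ((r ^+ N)%:E * \esum_(p in G) (w p.1 p.2)%:E)).
  apply: ge_ereal_sup => _ [A [finA AG] <-].
  rewrite -ge0_mule_fsumr; last by move=> p; rewrite lee_fin.
  apply: lee_wpmul2l; first by rewrite lee_fin exprn_ge0.
  by apply: ereal_sup_ubound; exists A.
apply: lee_wpmul2l; first by rewrite lee_fin exprn_ge0.
by apply: ereal_sup_ubound; exists G.
Qed.

Let packing_lim_jump Z eps :
  packing_lim w Z eps < +oo -> packing_lim w' Z eps = 0.
Proof.
rewrite packing_limE => /ereal_inf_lt[_ [N0 _ <-]] fin.
have Mfin : packing_sup w Z eps N0 \is a fin_num.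
  by rewrite ge0_fin_numE// packing_sup_ge0.
pose M := fine (packing_sup w Z eps N0).
have cv : ((r ^+ N * M)%:E @[N --> \oo] --> (0%R : R)%:E).
  apply: cvg_EFin; first exact: nearW.
  rewrite -(mul0r M); apply: cvgMr_tmp; apply: cvg_expr.
  by rewrite ger0_norm.
apply/cvg_lim => //.
apply: (squeeze_cvge _ (cvg_cst 0) cv).
near=> N; rewrite packing_sup_ge0//=.
apply: (le_trans (packing_sup_jump _ _ _)).
rewrite EFinM fineK//; apply: lee_wpmul2l; first by rewrite lee_fin exprn_ge0.
by apply: packing_sup_nonincreasing; near: N; exact: nbhs_infty_ge.
Unshelve. all: by end_near. Qed.

Lemma packing_outer_jump Z eps :
  packing_outer w Z eps < +oo -> packing_outer w' Z eps = 0.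
Proof.
move=> /ereal_inf_lt[_ [Zs ZZs <-]] fin; apply/eqP; rewrite eq_le.
rewrite packing_outer_ge0// andbT; apply: ereal_inf_lbound; exists Zs => //.
apply: eseries0 => i _ _; apply: packing_lim_jump.
apply: le_lt_trans fin.
apply: (@le_trans _ _ (\sum_(0 <= k < i.+1) packing_lim w (Zs k) eps)).
  rewrite big_nat_recr//=; apply: leeDr; apply: sume_ge0 => k _.
  exact: packing_lim_ge0.
by apply: nneseries_lim_ge => k _ _; exact: packing_lim_ge0.
Qed.

End jump.

Lemma packing_pressure_eps_jump g Z eps (beta : R) :
  (packing_pressure_eps g Z eps < beta%:E ->
    packing_outer (pressure_weight g beta eps) Z eps = 0) /\
  (beta%:E < packing_pressure_eps g Z eps ->
    packing_outer (pressure_weight g beta eps) Z eps = +oo).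
Proof.
have jump (b b' : R) : (b < b')%R ->
    packing_outer (pressure_weight g b eps) Z eps < +oo ->
    packing_outer (pressure_weight g b' eps) Z eps = 0.
  move=> bb'; apply: (@packing_outer_jump _ _ (expR (b - b'))).
  - by move=> n x; exact: expR_ge0.
  - by move=> n x; exact: expR_ge0.
  - exact: expR_ge0.
  - by rewrite expR_lt1 subr_lt0.
  - move=> n x; rewrite /pressure_weight -expRM_natr -expRD addrA -mulrDl.
    by rewrite addrAC subrr add0r.
split.
- move=> /ereal_inf_lt[_ [b Pb0 <-]]; rewrite lte_fin => /jump; apply.
  by rewrite Pb0.
- move=> lt_beta; apply: contrapT => /eqP; rewrite -ltey => fin.
  have le_crit (b : R) : (beta < b)%R -> packing_pressure_eps g Z eps <= b%:E.
    by move=> bb; apply: ereal_inf_lbound; exists b => //; exact: jump fin.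
  move: lt_beta; rewrite ltNge => /negP; apply.
  by apply/lee_addgt0Pr => e e0; rewrite -EFinD le_crit// ltrDl.
Qed.

End bowen_packing.

(* Main.v *)
Require Import Defs.
From mathcomp Require Import all_boot all_order all_algebra.
From mathcomp Require Import all_classical all_reals all_analysis.
From mathcomp Require Import ring lra.
Import Order.TTheory GRing.Theory Num.Theory.
Import numFieldTopology.Exports.

Local Open Scope classical_set_scope.
Local Open Scope ring_scope.
Local Open Scope ereal_scope.

(** Write [P a] for the packing pressure of [- a * u], and [c <= u <= C] with
    [0 < c]. Comparing weights ball by ball gives, for [a <= a'],
    [P a' <= P a - (a' - a) * c] and [P a <= P a' + (a' - a) * C]
    ([packing_pressure_shift]). So [P] is infinite everywhere as soon as it is
    infinite at [0]; otherwise it is a strictly decreasing Lipschitz function,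
    and since [P 0 >= 0] it has exactly one root, which is nonnegative
    ([decreasing_lipschitz_root]).

    These comparisons pass to the limit only if the limits as [eps] tends to
    [0] exist. Shrinking [eps] allows more disjoint families but decreases the
    suprema over the balls, so the pressure at scale [eps] is not monotone.
    By uniform continuity, however, a supremum over a Bowen ball of length [n]
    differs from the value at the center by at most [n * d], where [d] is small
    with [eps]; the pressure is therefore nonincreasing in [eps] up to an
    arbitrarily small error, which is enough for convergence
    ([almost_nonincreasing_at_right_is_cvge]).

    The dimension and the pressure are built from the weights
    [expR (- a * sup S u)] and [expR (sup S (- a * u))], where [S] is the
    Birkhoff sum. For [0 <= a] the first is at most the second, so [P a < 0]
    bounds the dimension by [a] from above ([bsp_dim_le]). By uniform
    continuity again, the second exceeds the first by a factor at most
    [expR (n * d)], which is absorbed by a pressure parameter [d] still below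
    [P a] when [P a > 0]; hence the dimension is then at least [a]
    ([bsp_dim_ge]). Applying both on either side of the root gives the
    equality. *)

(** * Limits at the right of zero *)

(** The monotone envelopes [low] and [upp], the infimum and supremum of [F]
    over [`]0, e]], both converge; almost monotonicity says that [upp] exceeds
    the limit of [low] by an arbitrarily small amount. *)
Lemma almost_nonincreasing_at_right_is_cvge (R : realType) (F : R -> \bar R) :
  (forall d : R, (0 < d)%R -> \forall e \near 0^'+, forall e' : R,
    (0 < e')%R -> (e' <= e)%R -> F e <= F e' + d%:E) ->
  cvg (F e @[e --> 0^'+]).
Proof.
move=> almost.
pose low (e : R) := ereal_inf [set F x | x in [set` `]0%R, e]]].
pose upp (e : R) := ereal_sup [set F x | x in [set` `]0%R, e]]].
have subI (e e' : R) : (e' <= e)%R -> [set` `]0%R, e']] `<=` [set` `]0%R, e]].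
  move=> e'e x; rewrite /= !in_itv/= => /andP[-> xe']; exact: le_trans e'e.
have inI (e : R) : (0 < e)%R -> [set` `]0%R, e]] e.
  by move=> e0; rewrite /= in_itv/= e0 lexx.
have lowl : cvg (low e @[e --> 0^'+]).
  apply: nonincreasing_at_right_is_cvge; near=> b => x y _ _ xy.
  by apply: ereal_inf_le_tmp; apply: image_subset; exact: subI.
have uppl : cvg (upp e @[e --> 0^'+]).
  apply: nondecreasing_at_right_is_cvge; near=> b => x y _ _ xy.
  by apply: ereal_sup_le; apply: image_subset; exact: subI.
set l := lim _ in lowl; set l' := lim _ in uppl.
have low_upp : \forall e \near 0^'+, low e <= F e <= upp e.
  near=> e; have e0 : (0 < e)%R by near: e; exact: nbhs_right_gt.
  by apply/andP; split; [apply: ereal_inf_lbound|apply: ereal_sup_ubound];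
    exists e => //; exact: inI.
have ll' : l <= l'.
  apply: (lee_cvg_to lowl uppl).
  by apply: filterS low_upp => e /andP[]; exact: le_trans.
have low_le (x : R) : (0 < x)%R -> low x <= l.
  move=> x0; apply: (cvge_to_ge lowl); near=> y.
  apply: ereal_inf_le_tmp; apply: image_subset; apply: subI.
  by near: y; exact: nbhs_right_le.
have l'l : l' <= l.
  apply/lee_addgt0Pr => d d0; have [r /= r0 Fr] := almost d d0.
  apply: (cvge_to_le uppl); near=> e.
  apply: ge_ereal_sup => _ [x /itvP xe <-].
  have x0 : (0 < x)%R by rewrite xe.
  apply: (@le_trans _ _ (low x + d%:E)); last by rewrite leeD2r// low_le.
  rewrite -leeBlDr//; apply: le_ereal_inf_tmp => _ [y /itvP yx <-].
  rewrite leeBlDr//; apply: Fr; rewrite ?yx//=.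
  rewrite sub0r normrN gtr0_norm//.
  apply: (@le_lt_trans _ _ e); first by rewrite xe.
  by near: e; exact: nbhs_right_lt.
have Fl : F e @[e --> 0^'+] --> l.
  apply: (squeeze_cvge low_upp lowl).
  by rewrite (_ : l = l')//; apply/eqP; rewrite eq_le ll' l'l.
exact: cvgP Fl.
Unshelve. all: by end_near. Qed.

(** * Bowen balls and Birkhoff sums *)

Section bowen_balls.
Context {R : realType} {X : metricType R}.
Variable f : X -> X.
Implicit Types (g : X -> R) (eps : R).

Lemma bowen_ball_center n x eps : (0 <= eps)%R -> bowen_ball f n x eps x.
Proof.
move=> e0; rewrite /bowen_ball/= /bowen_dist.
by apply: bigmax_le => // i _; rewrite mdistxx.
Qed.

Lemma bowen_ball_mdist n x y eps (i : 'I_n) : bowen_ball f n x eps y ->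
  (mdist (iter i f x) (iter i f y) <= eps)%R.
Proof. by move=> /(le_trans _); apply; exact: le_bigmax. Qed.

Lemma sub_bowen_ball n x eps eps' : (eps' <= eps)%R ->
  bowen_ball f n x eps' `<=` bowen_ball f n x eps.
Proof. by move=> ee' y /= /le_trans; exact. Qed.

Lemma le_birkhoff_sum {g h : X -> R} n x : (forall y, g y <= h y)%R ->
  (birkhoff_sum f g n x <= birkhoff_sum f h n x)%R.
Proof. by move=> gh; exact: ler_sum. Qed.

Lemma birkhoff_sum_cst (c : R) n x : birkhoff_sum f (fun=> c) n x = (n%:R * c)%R.
Proof. by rewrite /birkhoff_sum sumr_const card_ord mulr_natl. Qed.

Lemma birkhoff_sumZ (a : R) g n x :
  birkhoff_sum f (fun y => a * g y)%R n x = (a * birkhoff_sum f g n x)%R.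
Proof. by rewrite /birkhoff_sum mulr_sumr. Qed.

Lemma birkhoff_sum_oscillation g eps d n x y :
  (forall x y, (mdist x y <= eps)%R -> (`|g x - g y| <= d)%R) ->
  bowen_ball f n x eps y ->
  (`|birkhoff_sum f g n x - birkhoff_sum f g n y| <= n%:R * d)%R.
Proof.
move=> osc xy; rewrite /birkhoff_sum -sumrB (le_trans (ler_norm_sum _ _ _))//.
apply: (@le_trans _ _ (\sum_(i < n) d)%R).
  by apply: ler_sum => i _; apply: osc; exact: bowen_ball_mdist.
by rewrite sumr_const card_ord mulr_natl.
Qed.

Lemma birkhoff_le_sup g (M : R) n x y eps : (forall x, g x <= M)%R ->
  bowen_ball f n x eps y ->
  (birkhoff_sum f g n y <= sup_birkhoff f g n x eps)%R.
Proof.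
move=> gM xy; apply: ub_le_sup; last by exists y.
exists (n%:R * M)%R => _ [z _ <-].
by rewrite -(birkhoff_sum_cst M n z); exact: le_birkhoff_sum.
Qed.

Lemma sup_birkhoff_le g (k : R) n x eps : (0 <= eps)%R ->
  (forall y, bowen_ball f n x eps y -> birkhoff_sum f g n y <= k)%R ->
  (sup_birkhoff f g n x eps <= k)%R.
Proof.
move=> e0 gk; apply: ge_sup; last by move=> _ [y xy <-]; exact: gk.
by exists (birkhoff_sum f g n x), x => //; exact: bowen_ball_center.
Qed.

End bowen_balls.

(** * Comparison of packing quantities *)

Section packing.
Context {R : realType} {X : metricType R}.
Variables (f : X -> X) (Z : set X).
Implicit Types (g h : X -> R) (eps : R) (w : nat -> X -> R).

Lemma packing_outer_le w w' eps eps' :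
  (forall n x, 0 <= w n x)%R -> (forall n x, w n x <= w' n x)%R ->
  (eps' <= eps)%R ->
  packing_outer f w Z eps <= packing_outer f w' Z eps'.
Proof.
move=> w0 ww' ee'.
have sup_le (Y : set X) N : packing_sup f w Y eps N <= packing_sup f w' Y eps' N.
  apply: ge_ereal_sup => _ [G [cG tG GP] <-].
  apply: (@le_trans _ _ (\esum_(p in G) (w' p.1 p.2)%:E)).
    by apply: le_esum => p _; rewrite lee_fin.
  apply: ereal_sup_ubound; exists G => //; split => // p q Gp Gq.
  move=> [y [py qy]]; apply: (tG p q Gp Gq); exists y.
  by split; [exact: sub_bowen_ball py|exact: sub_bowen_ball qy].
have lim_le (Y : set X) : packing_lim f w Y eps <= packing_lim f w' Y eps'.
  rewrite !packing_limE; apply: le_ereal_inf_tmp => _ [N _ <-].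
  by apply: le_trans (sup_le Y N); apply: ereal_inf_lbound; exists N.
apply: le_ereal_inf_tmp => _ [Zs ZZs <-].
apply: (@le_trans _ _ (\sum_(0 <= i <oo) packing_lim f w (Zs i) eps)).
  by apply: ereal_inf_lbound; exists Zs.
by apply: lee_nneseries => [i _ _|i _]; [exact: packing_lim_ge0|exact: lim_le].
Qed.

(** A packing of a nonempty piece of [Z] by a single ball already has mass at
    least [1]. *)
Lemma packing_outer_ge1 w eps : Z !=set0 -> (forall n x, 1 <= w n x)%R ->
  1 <= packing_outer f w Z eps.
Proof.
move=> [z Zz] w1; apply: le_ereal_inf_tmp => _ [Zs ZZs <-].
have w0 n x : (0 <= w n x)%R by exact: le_trans (w1 n x).
have [i _ Zsz] := ZZs _ Zz.
apply: (@le_trans _ _ (packing_lim f w (Zs i) eps)).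
  rewrite packing_limE; apply: le_ereal_inf_tmp => _ [N _ <-].
  apply: (@le_trans _ _ (w N.+1 z)%:E); first by rewrite lee_fin.
  apply: ereal_sup_ubound; exists [set (N.+1, z)].
    split; first exact: countable1.
      by move=> p q /= -> ->.
    by move=> p /= ->.
  by rewrite esum_set1// lee_fin.
apply: (@le_trans _ _ (\sum_(0 <= k < i.+1) packing_lim f w (Zs k) eps)).
  rewrite big_nat_recr//=; apply: leeDr; apply: sume_ge0 => k _.
  exact: packing_lim_ge0.
by apply: nneseries_lim_ge => k _ _; exact: packing_lim_ge0.
Qed.

(** All comparisons of pressures at given scales are instances of this one:
    an increase of the Birkhoff suprema by at most [k] per unit of time
    increases the critical value by at most [k]. *)
Lemma packing_pressure_eps_le g h (k eps eps' : R) : (eps' <= eps)%R ->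
  (forall n x,
    sup_birkhoff f g n x eps <= sup_birkhoff f h n x eps' + n%:R * k)%R ->
  packing_pressure_eps f g Z eps <= packing_pressure_eps f h Z eps' + k%:E.
Proof.
move=> ee' gh; rewrite -leeBlDr//; apply: le_ereal_inf_tmp => _ [b Pb <-].
rewrite leeBlDr; last by [].
apply: ereal_inf_lbound; exists (b + k)%R; last by [].
apply/eqP; rewrite eq_le; apply/andP; split; last first.
  by apply: packing_outer_ge0 => n x; exact: expR_ge0.
rewrite -Pb; apply: packing_outer_le => // n x; first exact: expR_ge0.
rewrite ler_expR opprD mulrDl -addrA lerD2l mulNr addrC lerBlDr mulrC.
exact: gh.
Qed.

Lemma packing_pressure_eps0_ge0 eps : Z !=set0 -> (0 <= eps)%R ->
  0 <= packing_pressure_eps f (fun=> 0%R) Z eps.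
Proof.
move=> Z0 e0; apply: le_ereal_inf_tmp => _ [b Pb <-]; rewrite lee_fin leNgt.
apply/negP => b0.
have : 1 <= packing_outer f (pressure_weight f (fun=> 0%R) b eps) Z eps.
  apply: packing_outer_ge1 => // n x.
  rewrite -expR0 ler_expR addr_ge0//.
    by rewrite mulr_ge0// oppr_ge0 ltW.
  apply: le_trans (birkhoff_le_sup f _ 0%R n x x eps _ _) => //.
    by rewrite birkhoff_sum_cst mulr0.
  exact: bowen_ball_center.
by rewrite Pb lee_fin ler10.
Qed.

End packing.

(** * Continuous functions on a compact metric space *)

(** Uniform continuity, as a bound on the oscillation at all small enough
    scales. *)
Lemma compact_near_oscillation (R : realType) (X : metricType R) (g : X -> R)
    (d : R) : compact [set: X] -> continuous g -> (0 < d)%R ->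
  \forall e \near 0^'+, forall x y, (mdist x y <= e)%R -> (`|g x - g y| <= d)%R.
Proof.
move=> cX cg d0.
have : \forall e \near (0^'+ : set_system R), [set: X] `<=`
    [set x | forall y, (mdist x y <= e)%R -> (`|g x - g y| <= d)%R].
  move/compact_near_coveringP : cX; apply => x _.
  have d20 : (0 < d / 2)%R by rewrite divr_gt0.
  have /cvgrPdist_le/(_ _ d20) := cg x.
  move=> /metricType_numDomainType.nbhs_mdistP[r /= r0 gr].
  have r20 : (0 < r / 2)%R by rewrite divr_gt0.
  exists ([set y | (mdist x y < r / 2)%R], [set e : R | (e < r / 2)%R]).
    split => /=; last exact: nbhs_right_lt.
    by apply/metricType_numDomainType.nbhs_mdistP; exists (r / 2)%R.
  move=> [y e] /= [xy er] z yz.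
  rewrite (splitr d) -(subrKA (g x)) (le_trans (ler_normD _ _))//.
  rewrite distrC lerD//; apply: gr => /=.
    by rewrite (lt_trans xy)// ltr_pdivrMr// ltr_pMr// ltr1n.
  have : ball x (r / 2 + r / 2)%R z.
    apply: (@ball_triangle _ _ y); rewrite ballEmdist//=.
    exact: le_lt_trans yz er.
  by rewrite ballEmdist/= -splitr.
by apply: filterS => e eX x y; exact: eX.
Qed.

Lemma compact_continuous_ubound (R : realType) (X : metricType R) (g : X -> R) :
  compact [set: X] -> continuous g -> exists M, forall x, (g x <= M)%R.
Proof.
move=> cX cg.
have /ex_strict_bound_gt0[k _ gk] : bounded_set (g @` [set: X]).
  apply/compact_bounded/continuous_compact => //.
  exact: continuous_subspaceT.
exists k => x; apply: (le_trans (ler_norm _)); apply/ltW/gk.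
by exists x.
Qed.

(** * The packing pressure *)

Section pressure.
Context {R : realType} {X : metricType R}.
Variables (f : X -> X) (Z : set X).
Implicit Types (g h : X -> R).

Lemma packing_pressure_eps_shift g h (k M eps : R) : (0 <= eps)%R ->
  (forall x, h x <= M)%R -> (forall x, g x <= h x + k)%R ->
  packing_pressure_eps f g Z eps <= packing_pressure_eps f h Z eps + k%:E.
Proof.
move=> e0 hM gh; apply: packing_pressure_eps_le => // n x.
apply: sup_birkhoff_le => // y xy.
apply: (@le_trans _ _ (birkhoff_sum f h n y + n%:R * k)%R).
  rewrite -(birkhoff_sum_cst f k n y) /birkhoff_sum -big_split/=.
  exact: ler_sum.
by rewrite lerD2r; exact: birkhoff_le_sup hM xy.
Qed.

Hypothesis cX : compact [set: X].

Lemma packing_pressure_eps_is_cvg g : continuous g ->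
  cvg (packing_pressure_eps f g Z eps @[eps --> 0^'+]).
Proof.
move=> cg; have [M gM] := compact_continuous_ubound _ _ _ cX cg.
apply: almost_nonincreasing_at_right_is_cvge => d d0.
near=> e => e' e'0 e'e.
have e0 : (0 <= e)%R by exact: le_trans (ltW e'0) e'e.
apply: packing_pressure_eps_le => // n x.
apply: sup_birkhoff_le => // y xy.
apply: (@le_trans _ _ (birkhoff_sum f g n x + n%:R * d)%R).
  rewrite -lerBlDl (le_trans (ler_norm _))// distrC.
  apply: birkhoff_sum_oscillation xy.
  by near: e; exact: compact_near_oscillation.
rewrite lerD2r; apply: birkhoff_le_sup gM _.
by apply: bowen_ball_center; exact: ltW.
Unshelve. all: by end_near. Qed.

Lemma packing_pressure_shift g h (k : R) : continuous g -> continuous h ->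
  (forall x, g x <= h x + k)%R ->
  packing_pressure f g Z <= packing_pressure f h Z + k%:E.
Proof.
move=> cg ch gh; have [M hM] := compact_continuous_ubound _ _ _ cX ch.
have cvgh := packing_pressure_eps_is_cvg h ch.
apply: (lee_cvg_to (packing_pressure_eps_is_cvg g cg)).
  by apply: (cvgeD _ cvgh (cvg_cst k%:E)); exact: fin_num_adde_defl.
by near=> e; apply: (packing_pressure_eps_shift g h k M).
Unshelve. all: by end_near. Qed.

Lemma packing_pressure0_ge0 : Z !=set0 -> 0 <= packing_pressure f (fun=> 0%R) Z.
Proof.
move=> Z0; apply: lime_ge.
  by apply: packing_pressure_eps_is_cvg => x; exact: cvg_cst.
by near=> e; apply: packing_pressure_eps0_ge0.
Unshelve. all: by end_near. Qed.

End pressure.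

(** * Pressure bounds for the packing dimension *)

Section dimension.
Context {R : realType} {X : metricType R}.
Variables (f : X -> X) (u : X -> R) (Z : set X).
Hypotheses (cX : compact [set: X]) (cu : continuous u).
Hypothesis u0 : forall x, (0 <= u x)%R.

Let ca (a : R) : continuous (fun x => - a * u x)%R.
Proof. by move=> x; apply: cvgM; [exact: cvg_cst|exact: cu]. Qed.

Lemma sup_birkhoff_ge0 n x eps : (0 <= eps)%R ->
  (0 <= sup_birkhoff f u n x eps)%R.
Proof.
move=> e0; have [M uM] := compact_continuous_ubound _ _ _ cX cu.
apply: (@le_trans _ _ (birkhoff_sum f u n x)); first exact: sumr_ge0.
by apply: birkhoff_le_sup uM _; exact: bowen_ball_center.
Qed.

(** Unlike the pressure, the dimension at scale [eps] is monotone in [eps]: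
    a smaller [eps] both enlarges the weights and allows more families. *)
Lemma bsp_dim_eps_is_cvg : cvg (bsp_dim_eps f u Z eps @[eps --> 0^'+]).
Proof.
have [M uM] := compact_continuous_ubound _ _ _ cX cu.
apply: nonincreasing_at_right_is_cvge; near=> b => e' e.
rewrite !in_itv/= => /andP[e'0 _] /andP[e0 _] e'e.
apply: le_ereal_inf_tmp => _ [a [a0 Pa] <-].
apply: ereal_inf_lbound; exists a; last by [].
split; first by [].
apply/eqP; rewrite eq_le packing_outer_ge0 ?andbT; last first.
  by move=> n x; exact: expR_ge0.
rewrite -Pa; apply: packing_outer_le => // n x; first exact: expR_ge0.
rewrite ler_expR !mulNr lerN2 ler_pM2l//.
apply: sup_birkhoff_le; first exact: ltW.
by move=> y xy; apply: birkhoff_le_sup uM _; exact: sub_bowen_ball xy.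
Unshelve. all: by end_near. Qed.

Lemma bsp_dim_le (a : R) : (0 < a)%R ->
  packing_pressure f (fun x => - a * u x)%R Z < 0 -> bsp_dim f u Z <= a%:E.
Proof.
move=> a0 Pa; have [M aM] := compact_continuous_ubound _ _ _ cX (ca a).
apply: lime_le; first exact: bsp_dim_eps_is_cvg.
have P0 : \forall e \near 0^'+,
    packing_pressure_eps f (fun x => - a * u x)%R Z e < 0.
  exact: (packing_pressure_eps_is_cvg f Z cX _ (ca a) _ (open_ereal_lt' Pa)).
near=> e; have e0 : (0 <= e)%R by near: e; exact: nbhs_right_ge.
apply: ereal_inf_lbound; exists a; last by [].
split; first by [].
apply/eqP; rewrite eq_le packing_outer_ge0 ?andbT; last first.
  by move=> n x; exact: expR_ge0.
have /(packing_pressure_eps_jump _ _ _ _ _).1 <- :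
    packing_pressure_eps f (fun x => - a * u x)%R Z e < 0%:E by near: e.
apply: packing_outer_le => // n x; first exact: expR_ge0.
rewrite ler_expR oppr0 mul0r add0r.
have xx := bowen_ball_center f n x e e0.
have [N uN] := compact_continuous_ubound _ _ _ cX cu.
apply: le_trans (birkhoff_le_sup f _ M n x x e aM xx).
rewrite birkhoff_sumZ !mulNr lerN2 ler_pM2l//.
exact: birkhoff_le_sup uN xx.
Unshelve. all: by end_near. Qed.

Lemma bsp_dim_ge (a : R) : (0 <= a)%R ->
  0 < packing_pressure f (fun x => - a * u x)%R Z -> a%:E <= bsp_dim f u Z.
Proof.
move=> a0 Pa; have [N uN] := compact_continuous_ubound _ _ _ cX cu.
have [d d0 dP] : exists2 d : R, (0 < d)%R &
    d%:E < packing_pressure f (fun x => - a * u x)%R Z.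
  move: Pa; case: (packing_pressure _ _ _) => [r| |]//.
    rewrite lte_fin => r0; exists (r / 2)%R; first by rewrite divr_gt0.
    by rewrite lte_fin ltr_pdivrMr// ltr_pMr// ltr1n.
  by exists 1%R => //; rewrite ltry.
(* [k] is the oscillation allowed for [u]: [2 * k * a] must not exceed [d], and
   [a + 1] avoids a division by zero when [a = 0]. *)
pose k : R := (d / (2 * (a + 1)))%R.
have a1 : (0 < a + 1)%R by rewrite ltr_wpDl.
have k0 : (0 < k)%R by rewrite divr_gt0// mulr_gt0.
apply: lime_ge; first exact: bsp_dim_eps_is_cvg.
have dPe : \forall e \near 0^'+,
    d%:E < packing_pressure_eps f (fun x => - a * u x)%R Z e.
  exact: (packing_pressure_eps_is_cvg f Z cX _ (ca a) _ (open_ereal_gt' dP)).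
near=> e; have e0 : (0 <= e)%R by near: e; exact: nbhs_right_ge.
apply: le_ereal_inf_tmp => _ [b [b0 Pb] <-]; rewrite lee_fin leNgt.
apply/negP => ba.
(* Below the critical value the outer packing mass is infinite. *)
have /(packing_pressure_eps_jump _ _ _ _ _).2 Py :
    d%:E < packing_pressure_eps f (fun x => - a * u x)%R Z e by near: e.
suff : packing_outer f (pressure_weight f (fun x => - a * u x)%R d e) Z e <=
    packing_outer f (bsp_weight f u b e) Z e by rewrite Py Pb.
apply: packing_outer_le => // n x; first exact: expR_ge0.
rewrite ler_expR.
have osc y : bowen_ball f n x e y ->
    (`|birkhoff_sum f u n x - birkhoff_sum f u n y| <= n%:R * k)%R.
  apply: birkhoff_sum_oscillation.
  by near: e; exact: compact_near_oscillation.
(* Lowering the exponent from [a] to [b] enlarges the weight, as the supremum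
   is nonnegative. *)
apply: (@le_trans _ _ (- a * sup_birkhoff f u n x e)%R); last first.
  by rewrite !mulNr lerN2 ler_wpM2r ?sup_birkhoff_ge0// ltW.
rewrite mulNr addrC lerBlDr; apply: sup_birkhoff_le => // y xy.
rewrite birkhoff_sumZ !mulNr.
(* Two center-to-point oscillations of at most [n * k] separate the supremum from
   any value on the ball. *)
have supy : (sup_birkhoff f u n x e <= birkhoff_sum f u n y + n%:R * k * 2)%R.
  apply: sup_birkhoff_le => // z xz.
  have := osc y xy; have := osc z xz.
  by rewrite !ler_norml => /andP[? ?] /andP[? ?]; lra.
have ak : (a * k * 2 <= d)%R.
  have -> : (a * k * 2 = d * (a / (a + 1)))%R.
    by rewrite /k; field; exact: lt0r_neq0.
  by rewrite ger_pMr// ler_pdivrMr// mul1r lerDl.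
have asup := ler_wpM2l a0 supy.
have nak := ler_wpM2l (ler0n R n) ak.
by rewrite mulrDr in asup; lra.
Unshelve. all: by end_near. Qed.

End dimension.

(** * The root of a strictly decreasing Lipschitz function *)

Section root.
Context {R : realType}.
Variables (phi : R -> \bar R) (c C : R).
Hypotheses (c0 : (0 < c)%R) (phi0 : 0 <= phi 0%R).
Hypothesis phi_dec : forall a a' : R, (a <= a')%R ->
  phi a' <= phi a + (- ((a' - a) * c))%:E.
Hypothesis phi_lip : forall a a' : R, phi a <= phi a' + (`|a - a'| * C)%:E.

Lemma decreasing_lipschitz_fin_num : phi 0%R < +oo ->
  forall a, phi a \is a fin_num.
Proof.
move=> phi0y a; rewrite fin_numElt; apply/andP; split.
  have := le_trans phi0 (phi_lip 0%R a).
  by case: (phi a) => // r; rewrite ltNyr.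
apply: le_lt_trans (phi_lip a 0%R) _.
by move: phi0y; case: (phi 0%R) => // r _; rewrite -EFinD ltry.
Qed.

Lemma decreasing_lipschitz_lt a a' : phi 0%R < +oo ->
  (a < a')%R -> phi a' < phi a.
Proof.
move=> /decreasing_lipschitz_fin_num fin aa'.
apply: le_lt_trans (phi_dec a a' (ltW aa')) _.
rewrite -(fineK (fin a)) -EFinD lte_fin gtrDl oppr_lt0.
by rewrite mulr_gt0// subr_gt0.
Qed.

Lemma decreasing_lipschitz_root : phi 0%R < +oo ->
  exists2 a, (0 <= a)%R & phi a = 0.
Proof.
move=> /decreasing_lipschitz_fin_num fin.
have phiE a : phi a = (fine (phi a))%:E by rewrite fineK.
pose psi a := fine (phi a).
have psi0 : (0 <= psi 0)%R by rewrite -lee_fin -phiE.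
have psi_lip a a' : (psi a <= psi a' + `|a - a'| * C)%R.
  by have := phi_lip a a'; rewrite (phiE a) (phiE a') -EFinD lee_fin.
have psi_cont : continuous psi.
  move=> a; apply/cvgrPdist_le => d d0.
  have C1 : (0 < `|C| + 1)%R by rewrite ltr_wpDl.
  near=> a'.
  have near_a : (`|a - a'| * C <= d)%R.
    apply: (@le_trans _ _ (`|a - a'| * (`|C| + 1))%R).
      by rewrite ler_wpM2l// (le_trans (ler_norm C))// lerDl.
    rewrite -ler_pdivlMr//; near: a'.
    by apply: cvgr_dist_le; [exact: cvg_id|exact: divr_gt0].
  have lip := psi_lip a a'; have := psi_lip a' a; rewrite distrC => lip'.
  by rewrite ler_norml; apply/andP; split; lra.
(* Decreasing at rate at least [c], [psi] has become nonpositive at [b]. *)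
pose b := (psi 0 / c)%R.
have b0 : (0 <= b)%R by rewrite divr_ge0// ltW.
have psib : (psi b <= 0)%R.
  have := phi_dec 0%R b b0; rewrite (phiE 0%R) (phiE b) -EFinD lee_fin.
  by rewrite subr0 divfK ?gt_eqF// subrr.
have [a aI a_root] : exists2 a, a \in `[0%R, b] & psi a = 0%R.
  apply: IVT => //; first exact: continuous_subspaceT.
  by rewrite ge_min psib orbT le_max psi0.
exists a; first by rewrite (itvP aI).
by rewrite phiE [fine _]a_root.
Unshelve. all: by end_near. Qed.

End root.

(** * The Bowen pressure formula *)

Theorem theorem3p6 (R : realType) (X : metricType R) (f : X -> X) (u : X -> R)
    (Z : set X) :
  compact [set: X] -> continuous f -> continuous u ->
  (forall x, 0 < u x)%R -> Z !=set0 ->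
  (packing_pressure f (fun=> 0%R) Z < +oo ->
    exists alpha : R,
      [/\ packing_pressure f (fun x => - alpha * u x)%R Z = 0,
          forall a : R, packing_pressure f (fun x => - a * u x)%R Z = 0 ->
            a = alpha &
          bsp_dim f u Z = alpha%:E]) /\
  (packing_pressure f (fun=> 0%R) Z = +oo ->
    (forall a : R, packing_pressure f (fun x => - a * u x)%R Z = +oo) /\
    bsp_dim f u Z = +oo).
Proof.
move=> cX _ cu u0 Z0; have u_ge0 x : (0 <= u x)%R by exact: ltW.
have [C uC] := compact_continuous_ubound _ _ _ cX cu.
have [c c0 cleu] : exists2 c, (0 < c)%R & forall x, (c <= u x)%R.
  have [z _] := Z0.
  have [||x _ ux] := @compact_EVT_min _ _ u _ _ cX.
  - by exists z.
  - exact: continuous_subspaceT.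
  by exists (u x) => // y; apply: ux; rewrite inE.
pose phi (a : R) := packing_pressure f (fun x => - a * u x)%R Z.
have ca (a : R) : continuous (fun x => - a * u x)%R.
  by move=> x; apply: cvgM; [exact: cvg_cst|exact: cu].
have phi_dec (a a' : R) : (a <= a')%R ->
    phi a' <= phi a + (- ((a' - a) * c))%:E.
  move=> aa'; apply: packing_pressure_shift => // x.
  have : ((a' - a) * c <= (a' - a) * u x)%R by rewrite ler_wpM2l// subr_ge0.
  by rewrite mulrBl [in X in (_ <= X)%R]mulrBl; lra.
have phi_lip (a a' : R) : phi a <= phi a' + (`|a - a'| * C)%:E.
  apply: packing_pressure_shift => // x.
  have : ((a' - a) * u x <= `|a - a'| * C)%R.
    apply: (@le_trans _ _ (`|a - a'| * u x)%R); last by rewrite ler_wpM2l.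
    by rewrite ler_wpM2r// distrC ler_norm.
  by rewrite mulrBl; lra.
have phi0E : phi 0%R = packing_pressure f (fun=> 0%R) Z.
  rewrite /phi; set g := (X in packing_pressure f X Z = _).
  suff -> : g = (fun=> 0%R) by [].
  by apply/funext => x; rewrite /g oppr0 mul0r.
have phi0 : 0 <= phi 0%R by rewrite phi0E; exact: packing_pressure0_ge0.
rewrite -phi0E; split=> [phi0y|phi0y].
- have [al al0 root_al] :=
    decreasing_lipschitz_root phi c C c0 phi0 phi_dec phi_lip phi0y.
  have dec := decreasing_lipschitz_lt phi c C c0 phi0 phi_dec phi_lip _ _ phi0y.
  exists al; split; first exact: root_al.
    move=> a root_a; have phia : phi a = 0 by exact: root_a.
    have [lt_a|lt_a|->//] := ltgtP a al.
      by have := dec _ _ lt_a; rewrite root_al phia ltxx.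
    by have := dec _ _ lt_a; rewrite root_al phia ltxx.
  apply/eqP; rewrite eq_le; apply/andP; split.
    apply/lee_addgt0Pr => e e0; rewrite -EFinD.
    have ale : (al < al + e)%R by rewrite ltrDl.
    apply: (bsp_dim_le _ _ _ cX cu); first exact: le_lt_trans ale.
    by rewrite -root_al; exact: dec.
  apply/lee_subgt0Pr => e e0; rewrite -EFinB.
  have [ae|ae] := leP 0%R (al - e)%R.
    apply: (bsp_dim_ge _ _ _ cX cu u_ge0); first exact: ae.
    by rewrite -root_al; apply: dec; rewrite gtrBl.
  (* Only nonnegative candidates enter the dimension. *)
  apply: lime_ge; first exact: bsp_dim_eps_is_cvg.
  near=> r; apply: le_ereal_inf_tmp => _ [b [b0 _] <-].
  by rewrite lee_fin; exact/ltW/(lt_trans ae).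
- have phiy (a : R) : phi a = +oo.
    have := phi_lip 0%R a; rewrite phi0y.
    by case: (phi a) => // r; rewrite -EFinD leye_eq.
  split; first exact: phiy.
  apply/eqyP => A A0.
  apply: (bsp_dim_ge _ _ _ cX cu u_ge0); first exact: ltW.
  by rewrite -/(phi A) phiy.
Unshelve. all: by end_near. Qed.
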